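(* For all integers $n \geq 1$ and $m \geq 0$, the set of increasing 1,2-trees with $n$ vertices and $m$ edges is in bijection with the set of Cayley trees with $n$ vertices and exactly $m-n+1$ twists.
   Context: All graphs are simple and undirected, with vertices labeled $1,\dots,n$; the vertex with label $x$ is denoted $\mathbf{x}$. Increasing 1,2-trees are defined inductively: the only increasing 1,2-tree with one vertex is the isolated vertex $\mathbf 1$; given an increasing 1,2-tree $T$ with $n$ vertices, one obtains an increasing 1,2-tree with $n+1$ vertices by choosing a clique of $T$ of size 1 or 2 (a vertex or an edge) and adding a new vertex $\mathbf{n+1}$ adjacent to all vertices of that clique. (Thus one repeatedly attaches a leaf to a vertex or a triangle to an edge.) A Cayley tree with $n$ vertices is a tree whose vertices are labeled bijectively by $1,\dots,n$ (no constraint on the labeling); it is rooted at $\mathbf 1$, which induces the notions of parent, child, descendant, and the subtree rooted at a vertex (the vertex together with all its descendants). For a subtree $S$, $\min(S)$ is the smallest label in $S$. An edge of a Cayley tree joining a vertex $\mathbf x$ to its child $\mathbf y$, where $S$ is the subtree rooted at $\mathbf y$, is called increasing if every label in $S$ is greater than $x$ (i.e. $x<\min(S)$), and is called a twist otherwise (i.e. $\min(S)<x$). *)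

(* Defs.v *)
From mathcomp Require Import all_boot all_order all_algebra.

Set Implicit Arguments.
Unset Strict Implicit.
Unset Printing Implicit Defensive.

(* A graph is given by its set of edges, an edge being a 2-element set of
   vertices. The vertices of a labeled graph with n vertices are the elements
   of 'I_n; the element i : 'I_n stands for the vertex with label i + 1. *)
Definition graph (V : finType) := {set {set V}}.

Definition simple_graph (V : finType) (G : graph V) : bool :=
  [forall e in G, #|e| == 2].

Definition adj (V : finType) (G : graph V) : rel V :=
  fun x y => [set x; y] \in G.

Definition clique (V : finType) (G : graph V) (C : {set V}) : bool :=
  [forall x in C, forall y in C, (x != y) ==> adj G x y].

Definition widen1 (n : nat) : 'I_n -> 'I_n.+1 := widen_ord (leqnSn n).

Definition attach (n : nat) (G : graph 'I_n) (C : {set 'I_n}) :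
    graph 'I_n.+1 :=
  [set [set widen1 x | x in e] | e : {set 'I_n} in G]
    :|: [set [set widen1 x; ord_max] | x in C].

Fixpoint inc12trees (n : nat) : {set graph 'I_n} :=
  match n with
  | 0 => set0
  | n'.+1 =>
    if n' is 0 then [set set0]
    else [set attach G C | G in inc12trees n',
            C in [set C | clique G C & (#|C| == 1) || (#|C| == 2)]]
  end.

Definition connected_graph (V : finType) (G : graph V) : bool :=
  [forall x, forall y, connect (adj G) x y].

(* A sequence without repetition has at most #|V| entries, so that bounding
   the length loses no cycle; see acyclicP. *)
Definition acyclic (V : finType) (G : graph V) : bool :=
  [forall k : 'I_#|V|.+1, forall s : k.-tuple V,
     ~~ ((2 < size s) && ucycleb (adj G) s)].

Lemma acyclicP (V : finType) (G : graph V) :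
  reflect (forall s : seq V, 2 < size s -> ~ ucycle (adj G) s) (acyclic G).
Proof.
apply: (iffP forallP) => [acG s s_gt2 cs | acG k].
  have lt_s : size s < #|V|.+1.
    by case/andP: cs => _ /card_uniqP <-; rewrite ltnS max_card.
  by have /forallP/(_ (in_tuple s))/negP := acG (Ordinal lt_s); case; apply/andP.
by apply/forallP=> s; apply/negP => /andP[s_gt2 cs]; apply: (acG s).
Qed.

Definition tree (V : finType) (T : graph V) : bool :=
  [&& simple_graph T, connected_graph T & acyclic T].

(* In the tree T rooted at r, y is a descendant of x (or x itself) when x lies
   on the simple path r :: s from r to y. *)
Definition descendant (V : finType) (T : graph V) (r x y : V) : bool :=
  [exists k : 'I_#|V|, exists s : k.-tuple V,
     [&& path (adj T) r s, uniq (r :: s), last r s == y & x \in r :: s]].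

Lemma descendantP (V : finType) (T : graph V) (r x y : V) :
  reflect (exists s : seq V,
             [/\ path (adj T) r s, uniq (r :: s), last r s = y & x \in r :: s])
          (descendant T r x y).
Proof.
apply: (iffP existsP) => [[k /existsP[s /and4P[p u /eqP l i]]] | [s [p u l i]]].
  by exists s.
have lt_s : size s < #|V|.
  by rewrite -[(size s).+1]/(size (r :: s)) -(card_uniqP u) max_card.
exists (Ordinal lt_s); apply/existsP; exists (in_tuple s).
by apply/and4P; split=> //; apply/eqP.
Qed.

Definition child (V : finType) (T : graph V) (r x y : V) : bool :=
  adj T x y && descendant T r x y.

Definition subtree (V : finType) (T : graph V) (r y : V) : {set V} :=
  [set z | descendant T r y z].

Definition increasing_edge (n : nat) (T : graph 'I_n) (r x y : 'I_n) : bool :=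
  [forall z in subtree T r y, x < z].

(* An edge is counted as the pair (x, y) of its parent end x and its child
   end y. *)
Definition twists (n : nat) (T : graph 'I_n) (r : 'I_n) : {set 'I_n * 'I_n} :=
  [set xy | child T r xy.1 xy.2 & ~~ increasing_edge T r xy.1 xy.2].

Definition inc12trees_edges (n m : nat) : {set graph 'I_n} :=
  [set G in inc12trees n | #|G| == m].

(* The number k of twists is an integer, so that k = m - n + 1 can be stated
   without truncated subtraction; n_gt0 provides the root, with label 1. *)
Definition cayley_trees_twists (n : nat) (n_gt0 : 0 < n) (k : int) :
    {set graph 'I_n} :=
  [set T | tree T & #|twists T (Ordinal n_gt0)|%:Z%R == k].

(* Main.v *)
(* Both families are counted by the same recurrence in n. A 1,2-tree with n
   vertices and m edges extends in n ways by a leaf and in m ways by a triangle.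
   For Cayley trees, the vertex v = n+1 is inserted into a tree with n vertices
   and k twists either as a leaf (n ways, no new twist), or as an inner vertex,
   all edges from v to its children being twists. In the latter case let x be
   the child of v whose subtree has the largest minimum, and M the set of the
   other children of v. Contracting v into x, i.e. making x a child of the
   parent of v and the elements of M children of x, removes exactly one twist; M then
   consists of twist children of x, and is an initial segment of the children of
   x for the order of the minima of subtrees. It is thus either empty (one
   choice for each of the n-1 edges) or determined by its last element (one choice for
   each of the k twists), which gives n-1+k ways, the number m of edges of a
   1,2-tree with n vertices for k = m-n+1. *)

Require Import Defs.
From mathcomp Require Import all_boot all_order all_algebra.
From mathcomp Require Import zify.

Set Implicit Arguments.
Unset Strict Implicit.
Unset Printing Implicit Defensive.

(** * Rooted parent functions *)

(** A rooted tree is encoded by its parent function, the root being its own parent. [fconnect f x y]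
    then says that [y] is [x] or an ancestor of [x]. *)
Definition rooted (V : finType) (r : V) (f : {ffun V -> V}) : bool :=
  (f r == r) && [forall x, fconnect f x r].

Definition parent_funs (V : finType) (r : V) : {set {ffun V -> V}} :=
  [set f | rooted r f].

Lemma fconnect_step (V : finType) (f : V -> V) (x y : V) :
  fconnect f x y = (x == y) || fconnect f (f x) y.
Proof.
apply/idP/orP => [/iter_findex|[/eqP->|]].
- case: (findex f x y) => [/= ->|k]; first by left.
  by rewrite iterSr => <-; right; apply: fconnect_iter.
- exact: connect0.
- exact/connect_trans/fconnect1.
Qed.

Lemma fconnect_stepN (V : finType) (f : V -> V) (x y : V) :
  x != y -> fconnect f x y = fconnect f (f x) y.
Proof. by move=> xy; rewrite fconnect_step (negbTE xy). Qed.

Section Rooted.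
Variables (V : finType) (r : V) (f : {ffun V -> V}).
Hypothesis f_rooted : rooted r f.

Lemma rooted_root : f r = r.
Proof. by case/andP: f_rooted => /eqP. Qed.

(** Induction from the root towards the leaves, on the number of steps from [x] to [r]. *)
Lemma rooted_ind (P : V -> Prop) :
  P r -> (forall x, x != r -> P (f x) -> P x) -> forall x, P x.
Proof.
move=> Pr IH x; case/andP: f_rooted => _ /forallP/(_ x)/iter_findex.
move: (findex f x r) => k; elim: k x => [|k IHk] x; first by move=> /= ->.
rewrite iterSr => /IHk Pfx; have [-> //|xr] := eqVneq x r.
exact: IH.
Qed.

Lemma fconnect_root y : fconnect f r y = (r == y).
Proof.
apply/idP/eqP => [/iter_findex <-|->]; last exact: connect0.
by elim: (findex f r y) => //= k <-; rewrite rooted_root.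
Qed.

Lemma parent_neq x : x != r -> f x != x.
Proof.
elim/rooted_ind: x => [|x xr IH _]; first by rewrite eqxx.
by apply/eqP => fx; move: IH; rewrite !fx eqxx => /(_ xr).
Qed.

(** A cycle through [x] and [y] also passes through [f x]; the induction hypothesis, used with [y]
    and then with [x], collapses it. *)
Lemma fconnect_anti x y : fconnect f x y -> fconnect f y x -> x = y.
Proof.
elim/rooted_ind: x y => [|x xr IH] y.
  by rewrite fconnect_root => /eqP.
have [//|xy] := eqVneq x y; rewrite fconnect_stepN // => fxy yx.
have fx_y : f x = y by apply: IH => //; apply: connect_trans yx (fconnect1 _ _).
rewrite -fx_y; apply: esym; apply: IH; first by rewrite fx_y.
exact: fconnect1.
Qed.

Lemma fconnect_parentF x : x != r -> fconnect f (f x) x = false.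
Proof.
move=> xr; apply/negP => /fconnect_anti/(_ (fconnect1 _ _))/eqP.
by rewrite (negbTE (parent_neq xr)).
Qed.

Lemma fconnect_linear z x y :
  fconnect f z x -> fconnect f z y -> fconnect f x y || fconnect f y x.
Proof.
elim/rooted_ind: z => [|z zr IH].
  by rewrite !fconnect_root => /eqP <- /eqP <-; rewrite connect0.
have [<- _ ->//|zx] := eqVneq z x; have [<- -> _|zy] := eqVneq z y.
  by rewrite orbT.
by rewrite !(@fconnect_stepN _ _ z) //; apply: IH.
Qed.

(** Ancestors of [z] are comparable; if [x] were strictly below [y], then its parent, which is also
    the parent of [y], would be below [y]. *)
Lemma siblings_disjoint z x y : x != r -> y != r -> f x = f y ->
  fconnect f z x -> fconnect f z y -> x = y.
Proof.
move=> xr yr fxy zx zy; apply/eqP/negPn/negP => xy.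
case/orP: (fconnect_linear zx zy).
  by rewrite fconnect_stepN // fxy fconnect_parentF.
by rewrite fconnect_stepN 1?eq_sym // -fxy fconnect_parentF.
Qed.

End Rooted.

(** * Minima of subtrees and twists *)

Section MinLabel.
Variables (V : finType) (lab : V -> nat).
Implicit Type f : {ffun V -> V}.

Definition min_label f y := lab [arg min_(z < y | fconnect f z y) lab z].

Lemma min_labelP f y :
  (exists2 z, fconnect f z y & min_label f y = lab z) /\
  (forall z, fconnect f z y -> min_label f y <= lab z).
Proof.
rewrite /min_label; case: arg_minnP => [|z zy zmin]; first exact: connect0.
by split=> //; exists z.
Qed.

Lemma min_label_le f y z : fconnect f z y -> min_label f y <= lab z.
Proof. by case: (min_labelP f y) => _; apply. Qed.

Lemma min_label_anti f x y :
  fconnect f x y -> min_label f y <= min_label f x.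
Proof.
move=> xy; case: (min_labelP f x) => -[z zx ->] _.
exact/min_label_le/(connect_trans zx).
Qed.

(** The edge is indexed by its child end. In a rooted tree with injective labels equality cannot
    occur, since [f y] lies outside the subtree of [y]. *)
Definition twist (r : V) f y := (y != r) && (min_label f y <= lab (f y)).

Definition num_twists r f := \sum_y twist r f y.

(** A vertex attaining both minima would lie in the subtrees of two siblings. *)
Lemma min_label_inj r f x y : injective lab -> rooted r f ->
  x != r -> y != r -> f x = f y -> min_label f x = min_label f y -> x = y.
Proof.
move=> lab_inj fr xr yr fxy; case: (min_labelP f x) => -[z zx ->] _.
case: (min_labelP f y) => -[t ty ->] _ /lab_inj zt.
by apply: (siblings_disjoint fr xr yr fxy zx); rewrite zt.
Qed.

End MinLabel.

(** * Inserting a vertex with the largest label *)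

Lemma sum_option (V : finType) (F : option V -> nat) :
  \sum_o F o = F None + \sum_x F (Some x).
Proof.
rewrite (bigD1 None) //=; congr (_ + _).
rewrite (reindex_omap Some id) => [|[]//].
by apply: eq_bigl => x /=; rewrite eqxx.
Qed.

Section Insertion.
Variables (V : finType) (r : V) (lab : V -> nat) (N : nat).
Hypotheses (lab_inj : injective lab) (lab_lt : forall x, lab x < N).
Implicit Types (f : {ffun V -> V}) (g : {ffun option V -> option V}).

(** [None] is the new vertex, with a label [N] above all others. *)
Definition olab (o : option V) := oapp lab N o.

Lemma olab_inj : injective olab.
Proof.
case=> [x|] [y|] //= e; first by rewrite (lab_inj e).
- by have := lab_lt x; rewrite e ltnn.
- by have := lab_lt y; rewrite -e ltnn.
Qed.

Lemma olab_le o : olab o <= N.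
Proof. by case: o => //= x; apply: ltnW. Qed.

Definition insert_leaf f (u : V) : {ffun option V -> option V} :=
  [ffun o => if o is Some w then Some (f w) else Some u].

(* The new vertex [None] subdivides the edge from [x] to its parent, and takes
   over the children of [x] that belong to [M]. *)
Definition insert_inner f (x : V) (M : {set V}) : {ffun option V -> option V} :=
  [ffun o => if o is Some w then
               if (w == x) || (w \in M) then None else Some (f w)
             else Some (f x)].

Definition none_is_leaf g := [forall x, g (Some x) != None].

(** * Insertion as a leaf *)

Section Leaf.
Variables (f : {ffun V -> V}) (u : V).
Hypothesis f_rooted : rooted r f.
Let g := insert_leaf f u.

Lemma insert_leaf_connect z w :
  fconnect g (Some z) (Some w) = fconnect f z w.
Proof.
apply/idP/idP => /iter_findex.
  move: (findex _ _ _) => k; elim: k z => [z [->]|k IH z]; first exact: connect0.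
  rewrite iterSr ffunE => /IH; exact/connect_trans/fconnect1.
move: (findex _ _ _) => k; elim: k z => [z /= ->|k IH z]; first exact: connect0.
rewrite iterSr => /IH; apply: connect_trans.
by have := fconnect1 g (Some z); rewrite ffunE.
Qed.

Lemma insert_leaf_rooted : rooted (Some r) g.
Proof.
case/andP: f_rooted => /eqP fr /forallP f_conn.
have conn z : fconnect g (Some z) (Some r) by rewrite insert_leaf_connect.
apply/andP; split; first by rewrite ffunE fr.
apply/forallP => -[z //|].
by rewrite fconnect_stepN // ffunE.
Qed.

Lemma insert_leaf_connectN z : fconnect g (Some z) None = false.
Proof.
elim/(rooted_ind f_rooted): z => [|z zr IH].
  by rewrite (fconnect_root insert_leaf_rooted).
by rewrite fconnect_stepN // ffunE.
Qed.

(** [None] may join the subtree of [y], but never attains the minimum there, since [y] itself has a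
    smaller label. *)
Lemma insert_leaf_min y : min_label olab g (Some y) = min_label lab f y.
Proof.
apply/eqP; rewrite eqn_leq; apply/andP; split.
  case: (min_labelP lab f y) => -[z zy ->] _.
  by apply: (@min_label_le _ olab _ _ (Some z)); rewrite insert_leaf_connect.
case: (min_labelP olab g (Some y)) => -[[z|] zy ->] _ /=.
  by apply: min_label_le; rewrite -insert_leaf_connect.
by apply/ltnW/(leq_ltn_trans _ (lab_lt y))/min_label_le/connect0.
Qed.

(** The subtree of [None] is [None] alone, with the largest label, so the new edge is increasing;
    the other edges keep their minima. *)
Lemma insert_leaf_num_twists :
  num_twists olab (Some r) g = num_twists lab r f.
Proof.
rewrite /num_twists sum_option; have -> : twist olab (Some r) g None = false.
  apply/negbTE; rewrite negb_and -ltnNge ffunE /=.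
  case: (min_labelP olab g None) => -[[z|] zN ->] _; last exact: lab_lt.
  by rewrite insert_leaf_connectN in zN.
apply: eq_bigr => y _; rewrite /twist insert_leaf_min ffunE //.
Qed.

End Leaf.

Lemma insert_leaf_inj f1 f2 u1 u2 :
  insert_leaf f1 u1 = insert_leaf f2 u2 -> f1 = f2 /\ u1 = u2.
Proof.
move=> /ffunP e; split; last by have := e None; rewrite !ffunE => -[].
by apply/ffunP => x; have := e (Some x); rewrite !ffunE => -[].
Qed.

Lemma insert_leafP g : rooted (Some r) g -> none_is_leaf g ->
  exists f u, rooted r f /\ g = insert_leaf f u.
Proof.
move=> g_rooted /forallP gN.
have [u gNu] : exists u, g None = Some u.
  have := parent_neq g_rooted (isT : None != Some r).
  by case: (g None) => [u|//]; exists u.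
(* The default [r] is never taken, since no vertex has [None] as its parent. *)
pose f := [ffun x => odflt r (g (Some x))].
have fE x : g (Some x) = Some (f x).
  by rewrite ffunE; case: (g (Some x)) (gN x).
have def_g : g = insert_leaf f u.
  by apply/ffunP => -[x|]; rewrite [RHS]ffunE ?fE.
exists f, u; split=> //; case/andP: g_rooted => gr /forallP g_conn.
rewrite fE in gr; apply/andP; split=> //.
by apply/forallP => x; rewrite -(insert_leaf_connect f u) -def_g.
Qed.

(** * Insertion as an inner vertex *)

Section Inner.
Variables (f : {ffun V -> V}) (x : V) (M : {set V}).
Hypotheses (f_rooted : rooted r f) (x_r : x != r).
Hypothesis sub_M : M \subset [set y | f y == x].
Let g := insert_inner f x M.

Let M_parent y : y \in M -> f y = x.
Proof. by move=> /(subsetP sub_M); rewrite inE => /eqP. Qed.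

Let M_root : r \notin M.
Proof.
apply/negP => /M_parent; rewrite (rooted_root f_rooted) => /esym/eqP.
by rewrite (negbTE x_r).
Qed.

Let M_neq y : y \in M -> y != x.
Proof.
move=> /M_parent fy; apply: contra_neq x_r => yx.
apply/eqP/negPn/negP => /(parent_neq f_rooted).
by rewrite -{1}yx fy eqxx.
Qed.

Let gM y : y \in M -> g (Some y) = None.
Proof. by rewrite ffunE => ->; rewrite orbT. Qed.

Let gx : g (Some x) = None.
Proof. by rewrite ffunE eqxx. Qed.

Let gN : g None = Some (f x).
Proof. by rewrite ffunE. Qed.

Let gE y : y != x -> y \notin M -> g (Some y) = Some (f y).
Proof. by rewrite ffunE => /negbTE -> /negbTE ->. Qed.

Lemma insert_inner_rooted : rooted (Some r) g.
Proof.
apply/andP; split; first by rewrite gE 1?eq_sym // (rooted_root f_rooted).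
have conn z : fconnect g (Some z) (Some r).
  elim/(rooted_ind f_rooted): z => [|z zr IH]; first exact: connect0.
  have [zM|zM] := boolP (z \in M).
    rewrite fconnect_stepN // gM // -gx -fconnect_stepN //.
    by rewrite -(M_parent zM).
  have [zx|zx] := eqVneq z x; last by rewrite fconnect_stepN // gE.
  by rewrite zx fconnect_stepN // gx fconnect_stepN // gN -zx.
apply/forallP => -[z //|].
by rewrite fconnect_stepN // gN.
Qed.

(** Paths of [f] survive up to a detour through [None], except that those coming from [M] now bypass
    [x]; hence the restriction on [w]. *)
Lemma insert_inner_connect z w :
  w != x -> fconnect g (Some z) (Some w) = fconnect f z w.
Proof.
move=> wx; elim/(rooted_ind f_rooted): z => [|z zr IH].
  by rewrite (fconnect_root insert_inner_rooted) (fconnect_root f_rooted).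
have [->|zw] := eqVneq z w; first by rewrite !connect0.
have zw' : Some z != Some w by [].
have xw : Some x != Some w by rewrite eq_sym.
rewrite (fconnect_stepN f zw) (fconnect_stepN g zw').
have [zM|zM] := boolP (z \in M).
  by rewrite gM // -gx -fconnect_stepN // -IH (M_parent zM).
have [zx|zx] := eqVneq z x; last by rewrite gE.
by rewrite zx gx fconnect_stepN // gN -zx.
Qed.

Lemma insert_inner_connectN z : fconnect g (Some z) None = fconnect f z x.
Proof.
elim/(rooted_ind f_rooted): z => [|z zr IH].
  rewrite (fconnect_root insert_inner_rooted) (fconnect_root f_rooted).
  by rewrite [r == x]eq_sym (negbTE x_r).
rewrite (@fconnect_stepN _ g) //.
have [->|zx] := eqVneq z x; first by rewrite gx !connect0.
rewrite (fconnect_stepN f zx).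
have [zM|zM] := boolP (z \in M); last by rewrite gE.
by rewrite gM // (M_parent zM) !connect0.
Qed.

(** In the new tree [x] and the elements of [M] are siblings, so no vertex lies below both [x] and
    an element of [M]. *)
Lemma insert_inner_connectx z : fconnect g (Some z) (Some x) ->
  fconnect f z x /\ (forall y, y \in M -> ~~ fconnect f z y).
Proof.
move=> zx; split=> [|y yM].
  rewrite -insert_inner_connectN; apply: connect_trans zx _.
  by rewrite -gx fconnect1.
apply/negP; rewrite -(@insert_inner_connect _ _ (M_neq yM)) => zy.
have xy : fconnect g (Some x) (Some y) = false.
  rewrite (insert_inner_connect _ (M_neq yM)) -(M_parent yM).
  by apply: (fconnect_parentF f_rooted); apply: contraNneq M_root => <-.
case/orP: (fconnect_linear insert_inner_rooted zy zx); last by rewrite xy.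
rewrite fconnect_stepN ?gM ?(M_neq yM) // => Nx.
have /(fconnect_anti insert_inner_rooted Nx) // : fconnect g (Some x) None.
by rewrite -gx fconnect1.
Qed.

Lemma insert_inner_min y :
  y != x -> min_label olab g (Some y) = min_label lab f y.
Proof.
move=> yx; apply/eqP; rewrite eqn_leq; apply/andP; split.
  case: (min_labelP lab f y) => -[z zy ->] _.
  by apply: (@min_label_le _ olab _ _ (Some z)); rewrite insert_inner_connect.
case: (min_labelP olab g (Some y)) => -[[z|] zy ->] _ /=.
  by apply: min_label_le; rewrite -insert_inner_connect.
by apply/ltnW/(leq_ltn_trans _ (lab_lt y))/min_label_le/connect0.
Qed.

Lemma insert_inner_minN : min_label olab g None = min_label lab f x.
Proof.
apply/eqP; rewrite eqn_leq; apply/andP; split.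
  case: (min_labelP lab f x) => -[z zy ->] _.
  by apply: (@min_label_le _ olab _ _ (Some z)); rewrite insert_inner_connectN.
case: (min_labelP olab g None) => -[[z|] zy ->] _ /=.
  by apply: min_label_le; rewrite -insert_inner_connectN.
by apply/ltnW/(leq_ltn_trans _ (lab_lt x))/min_label_le/connect0.
Qed.

(** The edge above [None] inherits the status of the old edge above [x], and the edge from [None] to
    [x] is the additional twist. The edges above [M] are twists both after the insertion, [None]
    having the largest label, and before it, by the hypothesis on minima. *)
Lemma insert_inner_num_twists :
    (forall y, y \in M -> min_label olab g (Some y) < min_label olab g (Some x)) ->
  num_twists olab (Some r) g = (num_twists lab r f).+1.
Proof.
move=> M_lt; rewrite /num_twists sum_option.
have -> : twist olab (Some r) g None = twist lab r f x.
  by rewrite /twist insert_inner_minN gN x_r.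
rewrite (bigD1 x) //= [in RHS](bigD1 x) //=.
have -> : twist olab (Some r) g (Some x).
  rewrite /twist gx x_r /=.
  by apply: leq_trans (min_label_le _ (connect0 _ _)) (olab_le _).
rewrite addnCA add1n; congr (_ + _).+1; apply: eq_bigr => y yx.
rewrite /twist; congr (nat_of_bool (_ && _)).
rewrite insert_inner_min //; have [yM|yM] := boolP (y \in M); last by rewrite gE.
rewrite gM // M_parent //=.
have -> : min_label lab f y <= N.
  exact: leq_trans (min_label_le _ (connect0 _ _)) (ltnW (lab_lt y)).
apply/esym/ltnW; rewrite -insert_inner_min //.
exact: leq_trans (M_lt y yM) (min_label_le _ (connect0 _ _)).
Qed.

End Inner.

Lemma none_is_leaf_insert_leaf f u : none_is_leaf (insert_leaf f u).
Proof. by apply/forallP => x; rewrite ffunE. Qed.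

Lemma none_is_leaf_insert_inner f x M : none_is_leaf (insert_inner f x M) = false.
Proof. by apply/negbTE/forallPn; exists x; rewrite ffunE eqxx. Qed.

(** The minima are taken after the insertion, when the subtree of [x] has lost the branches at [M].
    The condition singles out [x] among the children of [None]. *)
Definition inner_mark f x (M : {set V}) :=
  let g := insert_inner f x M in
  [&& x != r, M \subset [set y | f y == x] &
      [forall y in M, min_label olab g (Some y) < min_label olab g (Some x)]].

(** The inverse operation contracts [None] into its child [x] of largest minimum. *)
Lemma insert_innerP g : rooted (Some r) g -> ~~ none_is_leaf g ->
  exists f x M, [/\ rooted r f, inner_mark f x M & g = insert_inner f x M].
Proof.
move=> g_rooted /forallPn[c0]; rewrite negbK => c0C.
pose mn c := min_label olab g (Some c).
case: (@arg_maxnP _ c0 (fun c => g (Some c) == None) mn c0C) => x /eqP gx x_max.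
have [p gN] : exists p, g None = Some p.
  have := parent_neq g_rooted (isT : None != Some r).
  by case: (g None) => [u|//]; exists u.
have gr := rooted_root g_rooted.
have x_r : x != r by apply/eqP => xr; rewrite xr gr in gx.
pose M := [set y | (g (Some y) == None) && (y != x)].
(* The default [r] is never taken: outside [x] and [M] the parent in [g] is an old vertex. *)
pose f := [ffun w => if w == x then p else if w \in M then x
                     else odflt r (g (Some w))].
have def_g : g = insert_inner f x M.
  apply/ffunP => -[w|]; rewrite !ffunE ?eqxx //.
  have [->|wx] //= := eqVneq w x.
  have [|wM] := boolP (w \in M); first by rewrite inE => /andP[/eqP].
  by move: wM; rewrite inE wx andbT; case: (g (Some w)).
have f_rooted : rooted r f.
  apply/andP; split; first by rewrite ffunE [r == x]eq_sym (negbTE x_r) inE gr.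
  (* The induction runs along [g], with [None] replaced by its parent [p], where paths continue
     after the contraction. *)
  have conn o : fconnect f (odflt p o) r.
    elim/(rooted_ind g_rooted): o => [|[z|] zr] /=; first exact: connect0.
    - case e : (g (Some z)) => [t|] /= conn; apply: connect_trans (fconnect1 _ _) _.
        have -> // : f z = t.
        rewrite ffunE inE e /=; case: eqP => // zx.
        by move: e; rewrite zx gx.
      rewrite ffunE; case: ifP => // zx; rewrite inE e zx /=.
      by apply: connect_trans (fconnect1 _ _) _; rewrite ffunE eqxx.
    - by rewrite gN.
  by apply/forallP => z; have := conn (Some z).
exists f, x, M; split=> //; rewrite /inner_mark x_r -def_g /=.
apply/andP; split.
  apply/subsetP => y yM; have := yM.
  by rewrite !inE ffunE yM => /andP[_ /negbTE ->].
apply/forall_inP => y; rewrite inE => /andP[/eqP gy yx].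
have y_le : mn y <= mn x by apply: x_max; rewrite gy.
(* Strictness holds because distinct siblings have distinct minima. *)
rewrite ltn_neqAle [X in _ && X]y_le andbT; apply: contraNneq yx => e.
have y_r : y != r by apply: contra_eq_neq gy => ->; rewrite gr.
apply/eqP; have [//] : Some y = Some x.
by apply: (min_label_inj olab_inj g_rooted) e => //; rewrite gx gy.
Qed.

(** Both marks give [None] the same children. If [x1] and [x2] differed, each would belong to the
    other set and have a smaller minimum than the other. *)
Lemma insert_inner_inj f1 f2 x1 x2 M1 M2 :
    inner_mark f1 x1 M1 -> inner_mark f2 x2 M2 ->
  insert_inner f1 x1 M1 = insert_inner f2 x2 M2 ->
  [/\ f1 = f2, x1 = x2 & M1 = M2].
Proof.
move=> /and3P[_ sub1 /forall_inP lt1] /and3P[_ sub2 /forall_inP lt2] e.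
have children w : (w == x1) || (w \in M1) = (w == x2) || (w \in M2).
  by move/ffunP/(_ (Some w)): e; rewrite !ffunE; do 2!case: ifP.
have e_x : x1 = x2.
  apply/eqP/negPn/negP => x12.
  have /lt2 : x1 \in M2 by have := children x1; rewrite eqxx (negbTE x12).
  have /lt1 : x2 \in M1.
    by have := children x2; rewrite eqxx eq_sym (negbTE x12).
  by rewrite e => lt21; rewrite ltnNge (ltnW lt21).
subst x2; have x1M1 : x1 \notin M1 by apply/negP => /lt1; rewrite ltnn.
have x1M2 : x1 \notin M2 by apply/negP => /lt2; rewrite ltnn.
have e_M : M1 = M2.
  apply/setP => w; have [->|wx] := eqVneq w x1.
    by rewrite (negbTE x1M1) (negbTE x1M2).
  by have := children w; rewrite (negbTE wx).
subst M2; split=> //; apply/ffunP => w.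
have [->|wx] := eqVneq w x1.
  by move/ffunP/(_ None): e; rewrite !ffunE => -[].
have [wM|wM] := boolP (w \in M1).
  have := subsetP sub1 w wM; have := subsetP sub2 w wM.
  by rewrite !inE => /eqP -> /eqP ->.
by move/ffunP/(_ (Some w)): e; rewrite !ffunE (negbTE wx) (negbTE wM) => -[].
Qed.

(** * Counting the inner insertions *)

(** For a twist at [y], this is the initial segment ending at [y] of the children of [f y], ordered
    by the minima of their subtrees. *)
Definition lower_siblings f y :=
  [set c | (f c == f y) && (min_label lab f c <= min_label lab f y)].

Hypothesis lab_root : forall x, lab r <= lab x.

(** The root has the smallest label, so no edge below it is a twist: the parent end of a twist has
    an edge above it, which can be subdivided. *)
Lemma twist_lt f y : rooted r f -> twist lab r f y ->
  f y != r /\ min_label lab f y < lab (f y).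
Proof.
move=> f_rooted /andP[yr le]; have lt : min_label lab f y < lab (f y).
  rewrite ltn_neqAle le andbT; case: (min_labelP lab f y) => -[z zy ->] _.
  apply/eqP => /lab_inj zfy; rewrite zfy in zy.
  by rewrite (fconnect_parentF f_rooted) in zy.
split=> //; apply/eqP => fy; move: lt; rewrite fy ltnNge.
by case: (min_labelP lab f y) => -[z _ ->] _; rewrite lab_root.
Qed.

Lemma fconnect_child f x z : rooted r f -> fconnect f z x -> z != x ->
  exists2 c, fconnect f z c & f c = x.
Proof.
move=> f_rooted; elim/(rooted_ind f_rooted): z => [|z zr IH].
  by rewrite (fconnect_root f_rooted) => ->.
move=> zx z_x; have [fz|fz] := eqVneq (f z) x; first by exists z.
case: IH => // [|c zc fc]; first by rewrite -fconnect_stepN.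
exists c => //; exact: connect_trans (fconnect1 _ _) zc.
Qed.

(** Once the segment is detached, the subtree of [f y] retains [f y], whose label exceeds the
    minimum at [y] because of the twist, and the branches at children of larger minimum. *)
Lemma inner_mark_lower_siblings f y : rooted r f -> twist lab r f y ->
  inner_mark f (f y) (lower_siblings f y).
Proof.
move=> f_rooted y_tw; have [fy_r y_lt] := twist_lt f_rooted y_tw.
have sub : lower_siblings f y \subset [set c | f c == f y].
  by apply/subsetP => c; rewrite !inE => /andP[].
apply/and3P; split=> //; apply/forall_inP => c cy.
have [fc c_le] : f c = f y /\ min_label lab f c <= min_label lab f y.
  by move: cy; rewrite inE => /andP[/eqP].
have c_fy : c != f y.
  rewrite -fc eq_sym; apply: (parent_neq f_rooted); apply: contraNneq fy_r => cr.
  by rewrite -fc cr (rooted_root f_rooted).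
rewrite insert_inner_min //; apply: leq_ltn_trans c_le _.
case: (min_labelP olab (insert_inner f (f y) (lower_siblings f y)) (Some (f y))).
case=> -[z|] zfy -> _ /=; last first.
  exact: leq_ltn_trans (min_label_le _ (connect0 _ _)) (lab_lt y).
have [z_fy zNlow] := insert_inner_connectx f_rooted fy_r sub zfy.
have [-> //|zNfy] := eqVneq z (f y).
have [d zd fd] := fconnect_child f_rooted z_fy zNfy.
apply: leq_trans (min_label_le _ zd).
have : d \notin lower_siblings f y by apply/negP => /zNlow; rewrite zd.
by rewrite inE fd eqxx ltnNge.
Qed.

(** Take [y] in [M] of largest minimum. A child of [x] outside [M] stays below [x] after the
    insertion, so its minimum is at least that of the new subtree of [x], hence larger than the one
    at [y]. *)
Lemma inner_markP f x M : rooted r f -> inner_mark f x M -> M != set0 ->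
  exists2 y, twist lab r f y & x = f y /\ M = lower_siblings f y.
Proof.
move=> f_rooted /and3P[x_r sub /forall_inP lt] /set0Pn[y0 y0M].
have child c : c \in M -> f c = x.
  by move/(subsetP sub); rewrite inE => /eqP.
have xM : x \notin M by apply/negP => /lt; rewrite ltnn.
have neq c : f c = x -> c != r.
  by move=> fc; apply: contraNneq x_r => cr; rewrite -fc cr (rooted_root f_rooted).
have neqx c : f c = x -> c != x.
  by move=> fc; have := parent_neq f_rooted (neq c fc); rewrite fc eq_sym.
case: (@arg_maxnP _ y0 (mem M) (min_label lab f) y0M) => y yM y_max.
have fy := child y yM; have := lt y yM.
rewrite insert_inner_min ?neqx // => y_lt.
exists y.
  rewrite /twist neq // fy; apply/ltnW/(leq_trans y_lt).
  exact: (@min_label_le _ olab _ _ (Some x) (connect0 _ _)).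
split=> //; apply/setP => c; rewrite inE fy.
apply/idP/andP => [cM|[/eqP fc c_le]]; 
  first by rewrite child //; split=> //; apply: y_max.
apply/negPn/negP => cM; have := leq_trans y_lt (min_label_anti _ _).
move=> /(_ (Some c)); rewrite insert_inner_min ?neqx // ltnNge c_le.
case/(_ _)/notF; rewrite fconnect_stepN; last by rewrite eqE /= neqx.
by rewrite ffunE (negbTE (neqx c fc)) (negbTE cM) fc.
Qed.

Lemma num_twistsE f : num_twists lab r f = #|[set y | twist lab r f y]|.
Proof.
by rewrite -sum1dep_card big_mkcond; apply: eq_bigr => y _; case: twist.
Qed.

(** Marks with empty [M] correspond to the vertices other than the root, the remaining ones to the
    twists. *)
Lemma card_inner_marks f : rooted r f ->
  #|[set q | inner_mark f q.1 q.2]| = #|V|.-1 + num_twists lab r f.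
Proof.
move=> f_rooted; pose A := [set (x, set0 : {set V}) | x in predC1 r].
pose B := [set (f y, lower_siblings f y) | y in [set y | twist lab r f y]].
have -> : [set q | inner_mark f q.1 q.2] = A :|: B.
  apply/setP => -[x M]; rewrite !inE /=; apply/idP/orP.
    move=> mark; have [->|M0] := eqVneq M set0.
      by left; apply/imsetP; exists x => //; case/and3P: mark.
    have [y y_tw [-> ->]] := inner_markP f_rooted mark M0.
    by right; apply/imsetP; exists y; rewrite ?inE.
  case=> /imsetP[y y_in [-> ->]].
    apply/and3P; split=> //; first exact: sub0set.
    by apply/forall_inP => c; rewrite inE.
  by apply: inner_mark_lower_siblings; rewrite inE in y_in.
rewrite cardsU; have -> : A :&: B = set0.
  apply/eqP/set0Pn => -[q /setIP[/imsetP[x _ ->] /imsetP[y _ [_ /setP/(_ y)]]]].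
  by rewrite !inE eqxx leqnn.
rewrite cards0 subn0 !card_in_imset ?cardC1 ?num_twistsE //; last first.
  by move=> x y _ _ [].
(* Each of [y1] and [y2] lies in the common segment, so the two siblings have equal minima. *)
move=> y1 y2; rewrite !inE => tw1 tw2 [fy e].
have le12 : min_label lab f y1 <= min_label lab f y2.
  by move/setP/(_ y1): e; rewrite !inE eqxx leqnn => /esym/andP[].
have le21 : min_label lab f y2 <= min_label lab f y1.
  by move/setP/(_ y2): e; rewrite !inE eqxx leqnn => /andP[].
case/andP: tw1 => y1r _; case/andP: tw2 => y2r _.
by apply: (min_label_inj lab_inj f_rooted) => //; apply/eqP; rewrite eqn_leq le12.
Qed.

(** An arbitrary weight [F] expresses the recurrence for all numbers of twists at once. The two
    terms come from [None] being a leaf or an inner vertex. *)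
Lemma sum_parent_funs_option (F : nat -> nat) :
  \sum_(g in parent_funs (Some r)) F (num_twists olab (Some r) g) =
  \sum_(f in parent_funs r)
     (#|V| * F (num_twists lab r f) +
      (#|V|.-1 + num_twists lab r f) * F (num_twists lab r f).+1).
Proof.
rewrite (bigID none_is_leaf) big_split /=; congr (_ + _).
  pose h (q : {ffun V -> V} * V) := insert_leaf q.1 q.2.
  transitivity (\sum_(g in h @: setX (parent_funs r) setT)
                  F (num_twists olab (Some r) g)).
    apply: eq_bigl => g; apply/andP/imsetP => [[]|[[f u]]].
      rewrite inE => g_rooted /(insert_leafP g_rooted)[f [u [fr ->]]].
      by exists (f, u); rewrite // !inE fr.
    rewrite !inE andbT /= => fr ->.
    by rewrite none_is_leaf_insert_leaf insert_leaf_rooted.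
  rewrite big_imset; last first.
    by move=> [f1 u1] [f2 u2] _ _ /insert_leaf_inj[/= -> ->].
  have sum_const k : #|V| * k = \sum_(u : V) k.
    by rewrite big_const iter_addn_0 mulnC.
  under [RHS]eq_bigr => f _ do rewrite sum_const.
  rewrite pair_big /=; apply: eq_big => [q|q]; first by rewrite !inE.
  by rewrite !inE andbT => q_r; rewrite insert_leaf_num_twists.
pose h (q : {ffun V -> V} * (V * {set V})) := insert_inner q.1 q.2.1 q.2.2.
pose D := [set q : {ffun V -> V} * (V * {set V}) |
             (q.1 \in parent_funs r) && inner_mark q.1 q.2.1 q.2.2].
transitivity (\sum_(g in h @: D) F (num_twists olab (Some r) g)).
  apply: eq_bigl => g; apply/andP/imsetP => [[]|[[f [x M]]]].
    rewrite inE => g_rooted /(insert_innerP g_rooted)[f [x [M [fr mark ->]]]].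
    by exists (f, (x, M)); rewrite // !inE fr.
  rewrite !inE /= => /andP[fr /and3P[x_r sub _]] ->.
  by rewrite none_is_leaf_insert_inner insert_inner_rooted.
rewrite big_imset; last first.
  move=> [f1 [x1 M1]] [f2 [x2 M2]]; rewrite !inE /= => /andP[_ mark1] /andP[_ mark2].
  by case/(insert_inner_inj mark1 mark2) => -> -> ->.
transitivity (\sum_(f in parent_funs r) \sum_(q | inner_mark f q.1 q.2)
                F (num_twists lab r f).+1).
  rewrite pair_big_dep /=; apply: eq_big => [q|q]; first by rewrite inE.
  rewrite !inE => /andP[fr /and3P[x_r sub /forall_inP lt]].
  by rewrite insert_inner_num_twists.
apply: eq_bigr => f; rewrite inE => fr; rewrite -card_inner_marks //.
by rewrite -sum_nat_const; apply: eq_bigl => q; rewrite inE.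
Qed.

End Insertion.

(** * Transport along a bijection of the vertices *)

Section Relabel.
Variables (V W : finType) (h : W -> V) (h' : V -> W).
Hypotheses (hK : cancel h h') (h'K : cancel h' h).
Variables (lab : V -> nat) (labW : W -> nat) (r : V).
Hypothesis labWE : forall w, labW w = lab (h w).

Definition relabel (f : {ffun V -> V}) : {ffun W -> W} :=
  [ffun w => h' (f (h w))].

Lemma relabel_connect f w1 w2 :
  fconnect (relabel f) w1 w2 = fconnect f (h w1) (h w2).
Proof.
have iterE k w : h (iter k (relabel f) w) = iter k f (h w).
  by elim: k => //= k <-; rewrite ffunE h'K.
apply/idP/idP => /iter_findex; first by move=> <-; rewrite iterE fconnect_iter.
by rewrite -iterE => /(can_inj hK) <-; rewrite fconnect_iter.
Qed.

Lemma relabel_rooted f : rooted (h' r) (relabel f) = rooted r f.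
Proof.
rewrite /rooted ffunE h'K (can_eq h'K); congr (_ && _).
apply/forallP/forallP => conn x; last by rewrite relabel_connect h'K.
by have := conn (h' x); rewrite relabel_connect !h'K.
Qed.

Lemma relabel_min f w : min_label labW (relabel f) w = min_label lab f (h w).
Proof.
apply/eqP; rewrite eqn_leq; apply/andP; split.
  case: (min_labelP lab f (h w)) => -[z zw ->] _.
  rewrite -[z]h'K -labWE; apply: min_label_le.
  by rewrite relabel_connect h'K.
case: (min_labelP labW (relabel f) w) => -[z zw ->] _.
by rewrite labWE; apply: min_label_le; rewrite -relabel_connect.
Qed.

Lemma relabel_num_twists f :
  num_twists labW (h' r) (relabel f) = num_twists lab r f.
Proof.
rewrite /num_twists (reindex h'); last by exists h => x _; rewrite ?hK ?h'K.
apply: eq_bigr => y _.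
by rewrite /twist relabel_min (can_eq h'K) labWE ffunE !h'K.
Qed.

Lemma sum_parent_funs_relabel (F : nat -> nat) :
  \sum_(g in parent_funs (h' r)) F (num_twists labW (h' r) g) =
  \sum_(f in parent_funs r) F (num_twists lab r f).
Proof.
rewrite (reindex relabel) /=; last first.
  exists (fun g : {ffun W -> W} => [ffun v => h (g (h' v))]) => f _.
    by apply/ffunP => v; rewrite !ffunE !h'K.
  by apply/ffunP => w; rewrite !ffunE !hK.
by apply: eq_big => f; rewrite ?inE ?relabel_rooted // relabel_num_twists.
Qed.

End Relabel.

Definition ord_num_twists n (f : {ffun 'I_n.+1 -> 'I_n.+1}) :=
  num_twists val ord0 f.

Lemma sum_parent_funs_ordS n (F : nat -> nat) :
  \sum_(g in parent_funs (ord0 : 'I_n.+2)) F (ord_num_twists g) =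
  \sum_(f in parent_funs (ord0 : 'I_n.+1))
     (n.+1 * F (ord_num_twists f) +
      (n + ord_num_twists f) * F (ord_num_twists f).+1).
Proof.
(* [None] becomes [ord_max], whose value [n.+1] is the label given by [olab]. *)
pose h' (o : option 'I_n.+1) : 'I_n.+2 := oapp (lift ord_max) ord_max o.
have hK : cancel (unlift ord_max) h' by move=> w; case: unliftP.
have h'K : cancel h' (unlift ord_max).
  by case=> [x|] /=; rewrite ?liftK ?unlift_none.
have labE (w : 'I_n.+2) : val w = olab val n.+1 (unlift ord_max w).
  by case: unliftP => [j ->|->] //=; rewrite -[RHS]lift_max.
have e0 : ord0 = h' (Some ord0) by apply/val_inj; rewrite /= /bump leqNgt.
rewrite /ord_num_twists e0 (sum_parent_funs_relabel hK h'K _ labE).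
rewrite (sum_parent_funs_option val_inj (@ltn_ord _)) //.
by rewrite card_ord.
Qed.

(** * Trees and parent functions *)

(** The root is left out because [f r = r] would give a one-element edge. *)
Definition tree_of (V : finType) (r : V) (f : {ffun V -> V}) : graph V :=
  [set [set x; f x] | x in predC1 r].

Lemma adj_sym (V : finType) (G : graph V) : symmetric (adj G).
Proof. by move=> x y; rewrite /adj setUC. Qed.

Section TreeOf.
Variables (V : finType) (r : V) (f : {ffun V -> V}).
Hypothesis f_rooted : rooted r f.
Let T := tree_of r f.

Lemma adj_tree_of x y :
  adj T x y = (x != r) && (f x == y) || (y != r) && (f y == x).
Proof.
apply/imsetP/orP => [[z zr e]|[/andP[xr /eqP<-]|/andP[yr /eqP<-]]]; last 2 first.
- by exists x.
- by exists y; rewrite // setUC.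
have fz : f z != z by apply: (parent_neq f_rooted).
have: z \in [set x; y] by rewrite e set21.
have: f z \in [set x; y] by rewrite e set22.
move=> /set2P fz_xy /set2P[zx|zy]; [left|right].
  by subst x; rewrite [z != r]zr; case: fz_xy => [e_fz|->];
    [rewrite e_fz eqxx in fz|rewrite eqxx].
by subst y; rewrite [z != r]zr; case: fz_xy => [->|e_fz];
  [rewrite eqxx|rewrite e_fz eqxx in fz].
Qed.

Lemma tree_of_simple : simple_graph T.
Proof.
apply/forall_inP => e /imsetP[x xr ->].
by rewrite cards2 [x == _]eq_sym (parent_neq f_rooted).
Qed.

Lemma tree_of_connected : connected_graph T.
Proof.
have to_root x : connect (adj T) x r.
  elim/(rooted_ind f_rooted): x => [|x xr IH]; first exact: connect0.
  apply: connect_trans IH; apply: connect1.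
  by rewrite adj_tree_of xr eqxx.
apply/forallP => x; apply/forallP => y; apply: connect_trans (to_root x) _.
by rewrite (sym_connect_sym (@adj_sym _ _)) to_root.
Qed.

Let depth x := #|[set w | fconnect f x w]|.

Let depth_parent x : x != r -> depth (f x) < depth x.
Proof.
move=> xr; apply: proper_card; apply/properP; split.
  by apply/subsetP => w; rewrite !inE; apply/connect_trans/fconnect1.
by exists x; rewrite !inE ?connect0 // (fconnect_parentF f_rooted).
Qed.

(* In a cycle, both neighbours of a deepest vertex would be its parent. *)
Lemma tree_of_acyclic : acyclic T.
Proof.
apply/acyclicP => -[//|x0 s0]; set s := _ :: _ => s_gt2 cyc.
have x0s : x0 \in s by rewrite mem_head.
case: (@arg_maxnP _ x0 (mem s) depth x0s) => x xs x_max.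
have [i s' def_s] := rot_to xs.
have size_s' : 2 < size (x :: s') by rewrite -def_s size_rot.
have mem_s y : y \in x :: s' -> depth y <= depth x.
  by rewrite -def_s mem_rot; apply: x_max.
have: ucycle (adj T) (x :: s') by rewrite -def_s rot_ucycle.
case: s' size_s' mem_s {def_s} => // y s'; case/lastP: s' => // s' z _ mem_s.
case/andP => /=; rewrite rcons_path last_rcons => /andP[xy /andP[_ zx]].
case/and3P => _ yz _; case/negP: yz; rewrite mem_rcons inE; apply/orP; left.
have nbr t : t \in x :: y :: rcons s' z -> adj T x t -> t = f x.
  move=> /mem_s t_le; rewrite adj_tree_of => /orP[/andP[_ /eqP]//|/andP[tr /eqP ft]].
  by have := depth_parent tr; rewrite ft ltnNge t_le.
have e_y : y = f x by apply: nbr xy; rewrite !inE eqxx orbT.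
have e_z : z = f x.
  by apply: nbr; rewrite 1?adj_sym // !inE mem_rcons mem_head !orbT.
by apply/eqP; rewrite e_z.
Qed.

Lemma tree_of_tree : tree T.
Proof. by rewrite /tree tree_of_simple tree_of_connected tree_of_acyclic. Qed.

(** A simple path from the root only goes downwards: a step to a parent would return to an ancestor
    already visited. *)
Lemma tree_of_path_ancestors s :
    path (adj T) r s -> uniq (r :: s) ->
  forall x, (x \in r :: s) = fconnect f (last r s) x.
Proof.
elim/last_ind: s => [|s z IH].
  by move=> _ _ x; rewrite inE (fconnect_root f_rooted) eq_sym.
rewrite rcons_path -rcons_cons rcons_uniq last_rcons => /andP[p uz] /andP[zs u] x.
rewrite mem_rcons in_cons IH //; move: uz; rewrite adj_tree_of.
case/orP=> /andP[ur /eqP e]; last by rewrite [RHS]fconnect_step e eq_sym.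
by rewrite IH // -e fconnect1 in zs.
Qed.

Lemma descendant_tree_of x y : descendant T r x y = fconnect f y x.
Proof.
apply/descendantP/idP => [[s [p u <-]]|]; first by rewrite tree_of_path_ancestors.
have [s [p u e]] : exists s, [/\ path (adj T) r s, uniq (r :: s) & last r s = y].
  elim/(rooted_ind f_rooted): y => [|y yr [s [p u e]]]; first by exists [::].
  exists (rcons s y); rewrite rcons_path p last_rcons e -rcons_cons rcons_uniq u.
  rewrite tree_of_path_ancestors // e (fconnect_parentF f_rooted) //.
  by rewrite adj_tree_of yr eqxx orbT.
by move=> yx; exists s; split; rewrite ?tree_of_path_ancestors ?e.
Qed.

Lemma child_tree_of x y : child T r x y = (y != r) && (f y == x).
Proof.
rewrite /child descendant_tree_of adj_tree_of.
apply/andP/andP => [[/orP[/andP[xr /eqP<-]|/andP[yr /eqP<-]]]|[yr /eqP<-]] //.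
  by rewrite (fconnect_parentF f_rooted).
by rewrite yr eqxx orbT fconnect1.
Qed.

End TreeOf.

Lemma tree_of_inj (V : finType) (r : V) :
  {in parent_funs r &, injective (tree_of r)}.
Proof.
move=> f1 f2; rewrite !inE => fr1 fr2 e; apply/ffunP => y.
have [->|yr] := eqVneq y r.
  by rewrite (rooted_root fr1) (rooted_root fr2).
have := child_tree_of fr1 (f1 y) y.
by rewrite e child_tree_of // yr eqxx => /eqP.
Qed.

(** Each vertex is sent to a neighbour closer to [r]. The resulting tree is a connected subgraph of
    [T], and a further edge of [T] would close a cycle. *)
Lemma tree_of_surj (V : finType) (r : V) (T : graph V) :
  tree T -> exists2 f, rooted r f & T = tree_of r f.
Proof.
case/and3P=> /forall_inP T_simple /forallP T_conn /acyclicP T_acyc.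
pose reach k x :=
  [exists s : k.-tuple V, path (adj T) x s && (last x s == r)].
have ex_reach x : exists k, reach k x.
  have /forallP/(_ r)/connectP[p p_path p_last] := T_conn x.
  by exists (size p); apply/existsP; exists (in_tuple p); rewrite p_path -p_last /=.
(* The distance from [x] to [r]. *)
pose d x := ex_minn (ex_reach x).
have step x : x != r -> exists y, adj T x y && (d y < d x).
  move=> xr; rewrite {2}/d; case: ex_minnP => -[|k] /existsP[s /andP[p l]] _.
    by move: l xr; rewrite tuple0 /= => ->.
  move: p l; case/tupleP: s => y s /= /andP[xy p] l; exists y; rewrite xy ltnS /=.
  rewrite /d; case: ex_minnP => j _; apply; apply/existsP; exists s.
  by rewrite p l.
pose f := [ffun x => if x == r then r
                     else odflt r [pick y | adj T x y && (d y < d x)]].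
have fP x : x != r -> adj T x (f x) && (d (f x) < d x).
  move=> xr; rewrite ffunE (negbTE xr); case: pickP => [y //|none].
  by have [y] := step x xr; rewrite none.
have f_rooted : rooted r f.
  apply/andP; split; first by rewrite ffunE eqxx.
  apply/forallP => x; have [k] := ubnP (d x); elim: k x => // k IH x x_lt.
  have [->|xr] := eqVneq x r; first exact: connect0.
  apply: connect_trans (fconnect1 _ _) _; apply: IH.
  have /andP[_ lt] := fP x xr; exact: leq_trans lt _.
exists f => //; apply/setP => e.
have subT : {subset tree_of r f <= T}.
  by move=> _ /imsetP[x xr ->]; case/andP: (fP x xr).
apply/idP/idP => [eT|/subT //]; apply/negPn/negP => eTf.
have /cards2P[u [w [uw def_e]]] := T_simple e eT.
have /forallP/(_ u)/forallP/(_ w)/connectP[p] := tree_of_connected f_rooted.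
case/shortenP => s s_path s_uniq _ s_last.
apply: (T_acyc (u :: s)).
  (* A path of length one would be the edge [e] itself, which is not in [tree_of r f]. *)
  case: s s_path s_last {s_uniq} => [_ wu|v [|//]]; first by rewrite wu eqxx in uw.
  by rewrite /= andbT => uv wv; rewrite def_e wv [_ \in _]uv in eTf.
apply/andP; split=> //; rewrite /= rcons_path -s_last adj_sym [adj _ _ _]/adj -def_e.
rewrite eT andbT; apply: sub_path s_path => x y; exact: subT.
Qed.

Lemma card_twists_tree_of n (r : 'I_n) (f : {ffun 'I_n -> 'I_n}) :
  rooted r f -> #|twists (tree_of r f) r| = num_twists val r f.
Proof.
move=> f_rooted; rewrite num_twistsE -(@card_imset _ _ (fun y => (f y, y))); last first.
  by move=> x y [].
apply: eq_card => -[x y]; rewrite !inE child_tree_of //=.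
apply/idP/imsetP => [/andP[/andP[yr /eqP fy]]|[z]].
  rewrite negb_forall_in => /exists_inP[z]; rewrite inE descendant_tree_of // -leqNgt.
  move=> zy zx; exists y; last by rewrite fy.
  rewrite inE /twist yr fy; exact: leq_trans (min_label_le _ zy) zx.
rewrite inE => /andP[zr le] [-> ->]; rewrite zr eqxx /=.
case: (min_labelP val f z) => -[t tz e] _; rewrite e in le.
rewrite negb_forall_in; apply/exists_inP; exists t; last by rewrite -leqNgt.
by rewrite inE descendant_tree_of.
Qed.

(** * Increasing 1,2-trees *)

Lemma widen1_inj n : injective (@widen1 n).
Proof. by move=> x y /(congr1 val) /= /val_inj. Qed.

Lemma widen1_neq_max n (x : 'I_n) : (widen1 x == ord_max) = false.
Proof. by rewrite -val_eqE /= ltn_eqF. Qed.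

Lemma max_notin_widen1 n (e : {set 'I_n}) : ord_max \notin @widen1 n @: e.
Proof. by apply/imsetP => -[x _ /esym/eqP]; rewrite widen1_neq_max. Qed.

(** Edges coming from [G] avoid [ord_max], whereas every new edge contains it; [G] and [C] can thus
    be read off from [attach G C]. *)
Lemma widen_edge_attach n (G : graph 'I_n) C (e : {set 'I_n}) :
  (@widen1 n @: e \in attach G C) = (e \in G).
Proof.
rewrite inE; apply/orP/idP => [[/imsetP[e' e'G]|/imsetP[x _ def_e]]|eG].
- by move/(imset_inj (@widen1_inj n)) ->.
- by have := max_notin_widen1 e; rewrite def_e set22.
- by left; apply: imset_f.
Qed.

Lemma new_edge_attach n (G : graph 'I_n) C (x : 'I_n) :
  ([set widen1 x; ord_max] \in attach G C) = (x \in C).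
Proof.
rewrite inE; apply/orP/idP => [[/imsetP[e _ def_e]|/imsetP[y yC def_e]]|xC].
- by have := max_notin_widen1 e; rewrite -def_e set22.
- have: widen1 x \in [set widen1 y; ord_max] by rewrite -def_e set21.
  by rewrite !inE widen1_neq_max orbF (inj_eq (@widen1_inj n)) => /eqP ->.
- by right; apply/imsetP; exists x.
Qed.

Lemma attach_inj n (G1 G2 : graph 'I_n) C1 C2 :
  attach G1 C1 = attach G2 C2 -> G1 = G2 /\ C1 = C2.
Proof.
move=> e; split; apply/setP => x.
  by rewrite -(widen_edge_attach G1 C1) e widen_edge_attach.
by rewrite -(new_edge_attach G1 C1) e new_edge_attach.
Qed.

Lemma card_attach n (G : graph 'I_n) C : #|attach G C| = #|G| + #|C|.
Proof.
rewrite cardsU disjoint_setI0; last first.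
  rewrite disjoint_subset; apply/subsetP => _ /imsetP[e _ ->]; rewrite !inE.
  apply/imsetP => -[x _ def_e].
  by have := max_notin_widen1 e; rewrite def_e set22.
rewrite cards0 subn0 card_imset ?card_imset //; last exact: imset_inj (@widen1_inj n).
move=> x y e; have: widen1 x \in [set widen1 y; ord_max] by rewrite -e set21.
by rewrite !inE widen1_neq_max orbF (inj_eq (@widen1_inj n)) => /eqP.
Qed.

Lemma attach_simple n (G : graph 'I_n) C :
  simple_graph G -> simple_graph (attach G C).
Proof.
move=> /forall_inP G_simple; apply/forall_inP => e /setUP[] /imsetP[x xG ->].
  by rewrite card_imset ?G_simple //; apply: widen1_inj.
by rewrite cards2 widen1_neq_max.
Qed.

Lemma inc12trees_simple n (G : graph 'I_n) : G \in inc12trees n -> simple_graph G.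
Proof.
elim: n G => [|[|n] IH] G; first by rewrite inE.
  by rewrite inE => /eqP->; apply/forall_inP => e; rewrite inE.
by case/imset2P => G' C /IH G'_simple _ ->; apply: attach_simple.
Qed.

Lemma clique_card1 (V : finType) (G : graph V) (C : {set V}) :
  #|C| == 1 -> clique G C.
Proof.
move=> /cards1P[x ->]; apply/forall_inP => y /set1P->.
by apply/forall_inP => z /set1P->; rewrite eqxx.
Qed.

Lemma clique_card2 (V : finType) (G : graph V) (C : {set V}) :
  simple_graph G -> clique G C && (#|C| == 2) = (C \in G).
Proof.
move=> /forall_inP G_simple.
apply/andP/idP => [[C_clique /cards2P[x [y [xy def_C]]]]|CG].
  move/forall_inP/(_ x): C_clique; rewrite def_C set21.
  by move=> /(_ isT)/forall_inP/(_ y); rewrite set22 => /(_ isT)/implyP/(_ xy).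
have C2 := G_simple C CG; split=> //; apply/forall_inP => x xC.
apply/forall_inP => y yC; apply/implyP => xy; rewrite /adj.
have -> // : [set x; y] = C.
apply/eqP; rewrite eqEcard (eqP C2) cards2 xy andbT.
by apply/subsetP => z /set2P[]->.
Qed.

(** The [n.+1] cliques of size one add one edge each; the cliques of size two are the edges of [G]
    and add two edges each. *)
Lemma sum_inc12trees n (F : nat -> nat) :
  \sum_(G in inc12trees n.+2) F #|G| =
  \sum_(G in inc12trees n.+1) (n.+1 * F #|G|.+1 + #|G| * F #|G|.+2).
Proof.
pose small (C : {set 'I_n.+1}) := (#|C| == 1) || (#|C| == 2).
pose D := [set q : graph 'I_n.+1 * {set 'I_n.+1} |
             (q.1 \in inc12trees n.+1) && (clique q.1 q.2 && small q.2)].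
pose h (q : graph 'I_n.+1 * {set 'I_n.+1}) := attach q.1 q.2.
transitivity (\sum_(G in h @: D) F #|G|).
  apply: eq_bigl => G; apply/imset2P/imsetP => [[G' C G'_in]|[[G' C]]].
    by rewrite inE => C_in ->; exists (G', C); rewrite // inE G'_in.
  by rewrite inE /= => /andP[G'_in C_in] ->; exists G' C; rewrite ?inE.
rewrite big_imset; last by move=> [G1 C1] [G2 C2] _ _ /attach_inj[/= -> ->].
transitivity (\sum_(G in inc12trees n.+1) \sum_(C | clique G C && small C)
                F (#|G| + #|C|)).
  rewrite pair_big_dep /=; apply: eq_big => [q|q _]; first by rewrite inE.
  by rewrite card_attach.
apply: eq_bigr => G /inc12trees_simple G_simple.
rewrite (bigID (fun C : {set _} => #|C| == 1)) /=; congr (_ + _).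
  have card_1 : #|[set C : {set 'I_n.+1} | #|C| == 1]| = n.+1.
    by rewrite card_draws bin1 card_ord.
  rewrite -[X in _ = X * _]card_1 -sum_nat_const; apply: eq_big => C; last first.
    by case/andP => _ /eqP->; rewrite addn1.
  rewrite inE /small; case: eqP => [/eqP C1|]; last by rewrite andbF.
  by rewrite clique_card1.
rewrite -sum_nat_const; apply: eq_big => C.
  rewrite -clique_card2 // /small -andbA; congr (_ && _).
  by case: eqP => [->|]; rewrite ?andbF ?andbT.
rewrite /small; case: eqP; rewrite ?andbF //= => _ /andP[/andP[_ /eqP->]].
by rewrite addn2.
Qed.

(** * Comparison of the two recurrences *)

Lemma parent_funs_ord1 : parent_funs (ord0 : 'I_1) = [set [ffun=> ord0]].
Proof.
apply/setP => f; rewrite !inE.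
have -> : f == [ffun=> ord0] by apply/eqP/ffunP => x; rewrite ffunE ord1.
by apply/andP; split; [rewrite ord1|apply/forallP => x; rewrite ord1 connect0].
Qed.

Lemma sum_inc12trees_parent_funs n (F : nat -> nat) :
  \sum_(G in inc12trees n.+1) F #|G| =
  \sum_(f in parent_funs (ord0 : 'I_n.+1)) F (n + ord_num_twists f).
Proof.
elim: n F => [|n IH] F.
  rewrite parent_funs_ord1 !big_set1 cards0; congr F.
  by rewrite /ord_num_twists /num_twists big_ord1.
(* The induction hypothesis is needed for this other weight, whence the quantification over [F]. *)
rewrite sum_inc12trees (IH (fun s => n.+1 * F s.+1 + s * F s.+2)).
rewrite (sum_parent_funs_ordS n (fun s => F (n.+1 + s))).
by apply: eq_bigr => f _; rewrite addSn addnS.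
Qed.

Lemma card_sum_eq (I : finType) (A : {set I}) (s : I -> nat) m :
  #|[set i in A | s i == m]| = \sum_(i in A) (s i == m).
Proof.
by rewrite -sum1dep_card big_mkcondr; apply: eq_bigr => i _; case: eqP.
Qed.

Lemma card_inc12trees_edges n m (n_gt0 : 0 < n) :
  #|inc12trees_edges n m| =
  #|cayley_trees_twists n_gt0 (m%:Z - n%:Z + 1)%R|.
Proof.
case: n n_gt0 => // n n_gt0; rewrite /cayley_trees_twists.
have -> : Ordinal n_gt0 = ord0 by apply: val_inj.
rewrite /inc12trees_edges card_sum_eq.
(* The indicator of [m] as weight turns the sums into cardinals. *)
rewrite (sum_inc12trees_parent_funs n (fun s => s == m)) -card_sum_eq.
rewrite -(@card_in_imset _ _ (tree_of ord0)); last first.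
  by move=> f1 f2 /setIdP[f1P _] /setIdP[f2P _]; apply: tree_of_inj.
apply: eq_card => T; rewrite [RHS]inE; apply/imsetP/andP => [[f]|[T_tree]].
  rewrite !inE => /andP[f_rooted /eqP m_eq] ->; rewrite tree_of_tree //.
  (* There are [n.+1] vertices here, so the prescribed number of twists is the integer m - n. *)
  rewrite card_twists_tree_of // -/(ord_num_twists f); split=> //; apply/eqP; lia.
have [f f_rooted ->] := tree_of_surj ord0 T_tree.
rewrite card_twists_tree_of // -/(ord_num_twists f) => /eqP tw_eq.
by exists f; rewrite // !inE f_rooted; apply/eqP; lia.
Qed.

Lemma bij_of_eq_card (T1 T2 : finType) :
  #|T1| = #|T2| -> exists f : T1 -> T2, bijective f.
Proof.
move=> e; exists (fun x => enum_val (cast_ord e (enum_rank x))).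
exists (fun y => enum_val (cast_ord (esym e) (enum_rank y))) => x.
  by rewrite enum_valK cast_ordK enum_rankK.
by rewrite enum_valK cast_ordKV enum_rankK.
Qed.

Theorem theorem1 (n m : nat) (n_gt0 : 0 < n) :
  exists f : {G : graph 'I_n | G \in inc12trees_edges n m} ->
             {T : graph 'I_n |
                T \in cayley_trees_twists n_gt0 (m%:Z - n%:Z + 1)%R},
    bijective f.
Proof.
by apply: bij_of_eq_card; rewrite !card_sig; apply: card_inc12trees_edges.
Qed.
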